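(* Let $\beta,\psi,k_{p,v},\alpha\in\mathbb{R}_{++}$ and $0<\underline{\sigma}_g\le\overline{\sigma}_g$ be known constants, let $\mu$ be a given weighting parameter, and let $\sigma_g\in[\underline{\sigma}_g,\overline{\sigma}_g]$ be an unknown constant. Assume that the optimization problem $$\begin{aligned}\text{minimize}\quad & -\underline{x}+\mu k\\ \text{subject to}\quad & k>0,\quad P\succ0,\quad \underline{Q}-\alpha P\succ0,\quad \overline{Q}-\alpha P\succ0,\\ & \underline{x}\ge1,\quad x_v\ge\underline{x},\quad x_\eta\ge\underline{x},\quad x_i\ge\underline{x},\end{aligned}$$ is feasible (decision variables: $k,\underline{x},x_v,x_\eta,x_i\in\mathbb{R}$ and the symmetric matrix $P\in\mathbb{R}^{3\times3}$; the matrices $\underline{Q},\overline{Q}$ are defined in the context). Let the gain $k$, the entries $p_v,p_{v\eta},p_{vi},p_\eta,p_{\eta i},p_i$ of $P$, and $\underline{x}$ be the values obtained from it, and set $\overline{\gamma}=1/\sqrt{\underline{x}}\in(0,1]$. Consider the open-loop error dynamics $$\dot{\widetilde v}_n=\sigma_g\widetilde u-\widetilde w_\sigma,\qquad \dot\eta=(\psi-\beta)(\eta-\psi\widetilde v_{fi})+\beta\widetilde v_n,\qquad \dot{\widetilde v}_{fi}=\eta-\psi\widetilde v_{fi},$$ with scalar disturbance $\widetilde w_\sigma\in\mathcal{L}_{2e}$, under the control law $$\widetilde u=-\frac{k}{\widehat\sigma_g}\widetilde v_n-k_{p,v}\eta$$ and the adaptive law $$\dot{\widehat\sigma}_g=-\frac{k\left(p_v\widetilde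 v_n+p_{v\eta}\eta+p_{vi}\widetilde v_{fi}\right)\widetilde v_n}{\widehat\sigma_g}.$$ Then, with $\widetilde\sigma_g=\sigma_g-\widehat\sigma_g$, the closed-loop error dynamics, in which $$\dot{\widetilde v}_n=-k\frac{\widetilde\sigma_g}{\widehat\sigma_g}\widetilde v_n-k\widetilde v_n-\sigma_gk_{p,v}\eta-\widetilde w_\sigma,$$ is $\overline{\gamma}$-dissipative from the disturbance vector $\widetilde{\mathbf w}=(p_v\widetilde w_\sigma,\;p_{v\eta}\widetilde w_\sigma,\;p_{vi}\widetilde w_\sigma)^\top$ to the output $\mathbf e_R=(\widetilde v_n,\eta,\widetilde v_{fi})^\top$. That is, there is an energy function $V\ge0$ of the state $(\widetilde v_n,\eta,\widetilde v_{fi},\widetilde\sigma_g)$ such that, along the closed-loop trajectories, $$\dot V\le\overline{\gamma}^2\|\widetilde{\mathbf w}\|^2-\|\mathbf e_R\|^2 .$$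
   Context: Notation: $\mathbb{R}_{++}$ is the set of strictly positive reals, $\|\cdot\|$ is the Euclidean norm, and $X\succ0$ means that $X$ is (symmetric) positive definite. $\mathcal{L}_{2e}$ is the extended $\mathcal{L}_2$ space: measurable signals on $[0,\infty)$ whose truncation to every $[0,T]$ is square integrable. Dissipativity: a system $\dot{\mathbf x}=\mathbf f(\mathbf x,\mathbf w)$, $\mathbf z=\mathbf h(\mathbf x)$ is dissipative with respect to the supply rate $s(\mathbf w,\mathbf z)\in\mathbb{R}$ if there is an energy function $V(\mathbf x)\ge0$ such that $V(\mathbf x(t_f))\le V(\mathbf x(t_0))+\int_{t_0}^{t_f}s(\mathbf w(\tau),\mathbf z(\tau))\,d\tau$ for all $t_f\ge t_0$ and all $\mathbf w$ with components in $\mathcal{L}_{2e}$. For $\gamma>0$ it is $\gamma$-dissipative if this holds with $s(\mathbf w,\mathbf z)=\gamma^2\|\mathbf w\|^2-\|\mathbf z\|^2$; in differential form, $\dot V\le\gamma^2\|\mathbf w\|^2-\|\mathbf z\|^2$. Origin of the variables: $\widetilde v_n$ is the tracking error of the voltage magnitude $v_n$ at the point of interconnection of a grid-following converter. $\widetilde v_f$ is the error of the filtered voltage magnitude $v_f$ (where $\dot v_f=-\beta v_f+\beta v_n$), and $\widetilde v_{fi}(t)=\int_0^t\widetilde v_f(\tau)\,d\tau$. $\eta=\widetilde v_f+\psi\widetilde v_{fi}$ is the normalized PI-controller output, where $\psi=k_{i,v}/k_{p,v}$ with PI gains $k_{p,v},k_{i,v}\in\mathbb{R}_{++}$. $\sigma_g=1/c_g$,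 where $c_g$ is the unknown constant grid capacitance lying in a known compact interval of positive numbers. $\widehat\sigma_g$ is the estimate of $\sigma_g$, and the trajectories considered are those along which the control and adaptive laws are defined ($\widehat\sigma_g\neq0$). $\widetilde w_\sigma=\sigma_g\widetilde w$ is the lumped disturbance, where $\widetilde w$ is the deviation of the grid-current disturbance from its nominal value. Matrices: $$P=\begin{bmatrix}p_v&p_{v\eta}&p_{vi}\\ p_{v\eta}&p_\eta&p_{\eta i}\\ p_{vi}&p_{\eta i}&p_i\end{bmatrix},\qquad Q=Q(\sigma_g)=\begin{bmatrix}Q_v&Q_{v\eta}&Q_{vi}\\ Q_{v\eta}&Q_\eta&Q_{\eta i}\\ Q_{vi}&Q_{\eta i}&Q_i\end{bmatrix},$$ where, with $x_v=1/\gamma_v^2$, $x_\eta=1/\gamma_\eta^2$, $x_i=1/\gamma_i^2$ for $\gamma_v,\gamma_\eta,\gamma_i\in\mathbb{R}_{++}$ (upper bounds on the $\mathcal{L}_2$ gains from the lumped disturbance to $\widetilde v_n$, $\eta$, $\widetilde v_{fi}$, respectively) and $\underline{x}=1/\overline{\gamma}^2$, $\overline\gamma$ standing for the maximum of $\gamma_v,\gamma_\eta,\gamma_i$ (imposed through the constraints $x_v,x_\eta,x_i\ge\underline{x}$), $$\begin{aligned} Q_v&=p_vk-p_{v\eta}\beta-1-\tfrac14x_v,\\ Q_\eta&=-p_\eta(\psi-\beta)+p_{v\eta}k_{p,v}\sigma_g-p_{\eta i}-1-\tfrac14x_\eta,\\ Q_i&=p_i\psi+p_{\eta i}\psi(\psi-\beta)-1-\tfrac14x_i,\\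 Q_{v\eta}&=\tfrac12\left(p_vk_{p,v}\sigma_g-p_\eta\beta-p_{v\eta}(\psi-\beta)-p_{vi}+p_{v\eta}k\right),\\ Q_{\eta i}&=\tfrac12\left(p_\eta\psi(\psi-\beta)+p_{vi}k_{p,v}\sigma_g-p_i+p_{\eta i}\psi\right),\\ Q_{vi}&=\tfrac12\left(p_{v\eta}\psi(\psi-\beta)+p_{vi}(\psi+k)-p_{\eta i}\beta\right). \end{aligned}$$ $\underline{Q}$ and $\overline{Q}$ denote $Q(\underline{\sigma}_g)$ and $Q(\overline{\sigma}_g)$, respectively. The constant $\alpha=1/\bar\tau$, where $\bar\tau>0$ is a prescribed settling time.
   Formalization: In Q_{ηi} the last term p_{ηi}ψ is replaced by p_{ηi}β, the coefficient that the closed-loop dynamics actually produce; with ψ as printed there are feasible designs for which the dissipativity claim fails. *)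

(* Defs.v *)
From HB Require Import structures.
From mathcomp Require Import all_boot all_order all_algebra.
From mathcomp Require Import all_classical all_reals all_analysis.

Set Implicit Arguments.
Unset Strict Implicit.
Unset Printing Implicit Defensive.

Import Order.TTheory GRing.Theory Num.Theory numFieldNormedType.Exports.

Local Open Scope classical_set_scope.
Local Open Scope ring_scope.

(* [`|v|] on matrices is the sup norm, hence a separate Euclidean norm. *)
Definition enorm (R : realType) (n : nat) (v : 'cV[R]_n) : R :=
  Num.sqrt (\sum_i v i 0 ^+ 2).

Definition posdef (R : realType) (n : nat) (M : 'M[R]_n) : Prop :=
  M^T = M /\ forall x : 'cV[R]_n, x != 0 -> 0 < (x^T *m M *m x) 0 0.

Definition colvec (R : realType) (n : nat) (s : seq R) : 'cV[R]_n :=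
  \col_(i < n) s`_i.

Definition sym3 (R : realType) (a b c d e f : R) : 'M[R]_3 :=
  \matrix_(i < 3, j < 3)
    (nth [::] [:: [:: a; b; c]; [:: b; d; e]; [:: c; e; f]] i)`_j.

(* Only the values of [u] on [0, +oo[ matter; [u \_ A] is 0 outside [A]. *)
Definition L2e (R : realType) (u : R -> R) : Prop :=
  forall T : R, 0 <= T ->
    (u \_ `[0, T]) \in Lfun (@lebesgue_measure R) 2%:E.

(* A system driven by an external signal d, with
     x' = dyn x d,   w = dist d,   z = output x,
   defined for the states of [dom].  The disturbance vector w that enters the
   supply rate may be a function of d other than the identity. *)
Record system (R : realType) (n q m p : nat) := System {
  dyn : 'cV[R]_n -> 'cV[R]_q -> 'cV[R]_n;
  dom : set 'cV[R]_n;
  dist : 'cV[R]_q -> 'cV[R]_m;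
  output : 'cV[R]_n -> 'cV[R]_p
}.

(* Caratheodory solutions: d is only locally square integrable, so the
   differential equation is required in integral form. *)
Definition trajectory (R : realType) (n q m p : nat) (S : system R n q m p)
    (d : R -> 'cV[R]_q) (t0 tf : R) (x : R -> 'cV[R]_n) : Prop :=
  (forall t, t0 <= t <= tf -> dom S (x t)) /\
  forall i : 'I_n,
    (@lebesgue_measure R).-integrable `[t0, tf]
      (fun t => (dyn S (x t) (d t) i 0)%:E) /\
    forall t, t0 <= t <= tf ->
      x t i 0 = x t0 i 0 +
        \int[@lebesgue_measure R]_(s in `[t0, t]) dyn S (x s) (d s) i 0.

(* [V] satisfies the dissipation inequality for the supply rate [s] along all
   trajectories, in integral form and in differential form. *)
Definition dissipation_inequality (R : realType) (n q m p : nat)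
    (S : system R n q m p) (s : 'cV[R]_m -> 'cV[R]_p -> R)
    (V : 'cV[R]_n -> R) : Prop :=
  forall (t0 tf : R) (d : R -> 'cV[R]_q) (x : R -> 'cV[R]_n),
    0 <= t0 -> t0 <= tf ->
    (forall j : 'I_q, L2e (fun t => d t j 0)) ->
    trajectory S d t0 tf x ->
    ((V (x tf))%:E <= (V (x t0))%:E +
       \int[@lebesgue_measure R]_(t in `[t0, tf])
          (s (dist S (d t)) (output S (x t)))%:E)%E.

Definition dissipation_rate (R : realType) (n q m p : nat)
    (S : system R n q m p) (s : 'cV[R]_m -> 'cV[R]_p -> R)
    (V : 'cV[R]_n -> R) : Prop :=
  forall (t0 tf : R) (d : R -> 'cV[R]_q) (x : R -> 'cV[R]_n),
    0 <= t0 -> t0 <= tf ->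
    (forall j : 'I_q, L2e (fun t => d t j 0)) ->
    trajectory S d t0 tf x ->
    {ae @lebesgue_measure R, forall t, t0 < t < tf ->
       derivable (V \o x) t 1 /\
       derive1 (V \o x) t <= s (dist S (d t)) (output S (x t))}.

Definition L2_supply (R : realType) (m p : nat) (gamma : R)
    (w : 'cV[R]_m) (z : 'cV[R]_p) : R :=
  gamma ^+ 2 * enorm w ^+ 2 - enorm z ^+ 2.

(* For an arbitrary [V] the almost-everywhere differential form does not imply
   the integral form, so both are required of the same [V]. *)
Definition gamma_dissipative (R : realType) (n q m p : nat)
    (S : system R n q m p) (gamma : R) : Prop :=
  exists V : 'cV[R]_n -> R,
    [/\ forall x, 0 <= V x,
        dissipation_inequality S (L2_supply gamma) V
      & dissipation_rate S (L2_supply gamma) V].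

Record opt_problem (R : realType) (X : Type) := OptProblem {
  objective : X -> R;
  feasible : X -> Prop
}.

Record design (R : realType) := Design {
  gain : R;
  x_low : R;
  x_v : R;
  x_eta : R;
  x_i : R;
  Pmx : 'M[R]_3
}.

(* Coordinates 0, 1, 2 are v_n, eta, v_fi.  With
     A = [-k, -sigma kp, 0; beta, psi - beta, -psi (psi - beta); 0, 1, -psi],
   Q is the symmetric part of - P A, minus the identity, minus
   diag (x_v, x_eta, x_i) / 4.  In particular p_ei enters q_ei with the
   coefficient psi - (psi - beta) = beta.  The source prints psi there, which
   breaks the identity and, numerically, admits feasible designs whose
   undriven closed loop oscillates forever. *)
Definition Qmx (R : realType) (beta psi kp : R) (z : design R) (sigma : R) :
    'M[R]_3 :=
  let k := gain z in
  let p_v := Pmx z 0 0 in let p_ve := Pmx z 0 1 in let p_vi := Pmx z 0 2 in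
  let p_e := Pmx z 1 1 in let p_ei := Pmx z 1 2 in let p_i := Pmx z 2 2 in
  let q_v := p_v * k - p_ve * beta - 1 - x_v z / 4 in
  let q_e := - p_e * (psi - beta) + p_ve * kp * sigma - p_ei - 1
             - x_eta z / 4 in
  let q_i := p_i * psi + p_ei * psi * (psi - beta) - 1 - x_i z / 4 in
  let q_ve := (p_v * kp * sigma - p_e * beta - p_ve * (psi - beta) - p_vi
               + p_ve * k) / 2 in
  let q_ei := (p_e * psi * (psi - beta) + p_vi * kp * sigma - p_i
               + p_ei * beta) / 2 in
  let q_vi := (p_ve * psi * (psi - beta) + p_vi * (psi + k) - p_ei * beta) / 2
  in sym3 q_v q_ve q_vi q_e q_ei q_i.

Definition gain_design (R : realType)
    (beta psi kp alpha sigma_lo sigma_hi mu : R) : opt_problem R (design R) := {|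
  objective := fun z => - x_low z + mu * gain z;
  feasible := fun z =>
    [/\ 0 < gain z,
        posdef (Pmx z),
        posdef (Qmx beta psi kp z sigma_lo - alpha *: Pmx z),
        posdef (Qmx beta psi kp z sigma_hi - alpha *: Pmx z)
      & [/\ 1 <= x_low z, x_low z <= x_v z, x_low z <= x_eta z
          & x_low z <= x_i z]]
|}.

Definition open_loop (R : realType) (beta psi sigma u w : R) (e : 'cV[R]_3) :
    'cV[R]_3 :=
  let v := e 0 0 in let eta := e 1 0 in let vi := e 2 0 in
  colvec 3 [:: sigma * u - w;
               (psi - beta) * (eta - psi * vi) + beta * v;
               eta - psi * vi].

Definition control_law (R : realType) (kp k sigma_hat : R) (e : 'cV[R]_3) : R :=
  - (k / sigma_hat) * e 0 0 - kp * e 1 0.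

Definition adaptive_law (R : realType) (k : R) (P : 'M[R]_3) (sigma_hat : R)
    (e : 'cV[R]_3) : R :=
  - (k * (P 0 0 * e 0 0 + P 0 1 * e 1 0 + P 0 2 * e 2 0) * e 0 0) / sigma_hat.

Definition err (R : realType) (x : 'cV[R]_(3 + 1)) : 'cV[R]_3 := usubmx x.

Definition sigma_tilde (R : realType) (x : 'cV[R]_(3 + 1)) : R :=
  dsubmx x 0 0.

Definition sigma_hat (R : realType) (sigma : R) (x : 'cV[R]_(3 + 1)) : R :=
  sigma - sigma_tilde x.

(* State (v_n, eta, v_fi, sigma_tilde); sigma is constant, so the derivative of
   sigma_tilde is minus that of sigma_hat. *)
Definition closed_loop (R : realType) (beta psi kp sigma k : R) (P : 'M[R]_3) :
    system R (3 + 1) 1 3 3 := {|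
  dyn := fun x w =>
    col_mx
      (open_loop beta psi sigma
         (control_law kp k (sigma_hat sigma x) (err x)) (w 0 0) (err x))
      (- adaptive_law k P (sigma_hat sigma x) (err x))%:M;
  dom := [set x | sigma_hat sigma x != 0];
  dist := fun w => colvec 3 [:: P 0 0 * w 0 0; P 0 1 * w 0 0; P 0 2 * w 0 0];
  output := @err R
|}.

(* Main.v *)
(* The energy function is V = (e^T P e + sigma_tilde^2) / 2.  The adaptive law
   is chosen so that the terms of V' carrying sigma_tilde cancel, which leaves
     V' = - e^T Q(sigma) e - |e|^2 - (x_v v^2 + x_eta eta^2 + x_i vi^2) / 4
          - (P e)_1 w.
   Q is affine in sigma and Q - alpha P is positive definite at both ends of
   the interval, so e^T Q(sigma) e >= 0; Young's inequality bounds the three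
   products in (P e)_1 w.
   Trajectories are only absolutely continuous, so this computation needs the
   product rule for indefinite Lebesgue integrals, obtained from Fubini on the
   triangle {s < r}; the almost-everywhere form is Lebesgue differentiation. *)
Require Import Defs.
From mathcomp Require Import all_boot all_order all_algebra.
From mathcomp Require Import all_classical all_reals all_analysis.
From mathcomp Require Import measurable_realfun ring lra.
Import Order.TTheory GRing.Theory Num.Theory numFieldNormedType.Exports.
Local Open Scope classical_set_scope.
Local Open Scope ring_scope.

Section IndefiniteIntegral.
Set Implicit Arguments.
Unset Strict Implicit.
Context {R : realType}.
Notation mu := (@lebesgue_measure R).
Implicit Types (f g F G : R -> R) (a b c t : R).

Lemma integral_triangle_swap f g a b :
  mu.-integrable `[a, b] (EFin \o f) -> mu.-integrable `[a, b] (EFin \o g) ->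
  \int[mu]_(s in `[a, b]) (f s * \int[mu]_(r in `]s, b]) g r) =
  \int[mu]_(r in `[a, b]) (g r * \int[mu]_(s in `[a, r]) f s).
Proof.
move=> fi gi; rewrite Rintegral_mkcond [RHS]Rintegral_mkcond.
pose fD : R -> R := f \_ `[a, b]; pose gD : R -> R := g \_ `[a, b].
have fDi : mu.-integrable setT (EFin \o fD).
  by rewrite -restrict_EFin; apply: (integrable_mkcond _ _).1.
have gDi : mu.-integrable setT (EFin \o gD).
  by rewrite -restrict_EFin; apply: (integrable_mkcond _ _).1.
have mfD : measurable_fun setT fD.
  by apply/measurable_EFinP; exact: measurable_int _ fDi.
have mgD : measurable_fun setT gD.
  by apply/measurable_EFinP; exact: measurable_int _ gDi.
pose T := measurableTypeR R.
pose tri : set (T * T) := [set p | p.1 < p.2].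
have mtri : measurable tri.
  rewrite -[X in measurable X]setTI.
  by apply: (measurable_fun_ltr (f := fst) (g := snd) _ _ measurableT
    (Y := [set true])).
have triE (x y : R) : \1_tri (x, y) = (x < y)%R%:R :> R.
  rewrite indicE; congr (_%:R); congr nat_of_bool.
  by apply/idP/idP; rewrite inE.
have pt0 : point = 0 :> R by [].
pose h : T * T -> \bar R := fun p => (fD p.1 * gD p.2 * \1_tri p)%:E.
have mh : measurable_fun setT h.
  apply/measurable_EFinP; apply: measurable_funM; last exact: measurable_indic.
  apply: measurable_funM; exact: measurableT_comp.
have hi : (mu \x mu)%E.-integrable setT h.
  apply/integrable12ltyP => //.
  have gDn : (\int[mu]_y `|(gD y)%:E| < +oo)%E by case/integrableP: gDi.
  apply: (@le_lt_trans _ _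
    (\int[mu]_x (`|(fD x)%:E| * \int[mu]_y `|(gD y)%:E|))%E).
    apply: ge0_le_integral => //.
    - by move=> x _; exact: integral_ge0.
    - apply: (measurable_fun_fubini_tonelli_F (abse \o h)) => //=.
      exact: measurableT_comp.
    - apply: emeasurable_funM => //.
      by apply: measurableT_comp => //; exact/measurable_EFinP.
    move=> x _.
    rewrite -ge0_integralZl//; last first.
      by apply: measurableT_comp => //; exact/measurable_EFinP.
    apply: ge0_le_integral => //.
    - by apply: measurableT_comp => //; exact: measurableT_comp.
    - apply: emeasurable_funM => //.
      by apply: measurableT_comp => //; exact/measurable_EFinP.
    move=> y _; rewrite /h /= -EFinM lee_fin !normrM ler_piMr//.
    by rewrite indicE; case: (_ \in _); rewrite ?normr1 ?normr0.
  rewrite ge0_integralZr//; last 2 first.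
    - by apply: measurableT_comp => //; exact/measurable_EFinP.
    - exact: integral_ge0.
  apply: lte_mul_pinfty => //; first exact: integral_ge0.
  by rewrite ge0_fin_numE; [case/integrableP: fDi | exact: integral_ge0].
have /(congr1 fine) := Fubini hi.
have sub_int (A : set R) : measurable A -> A `<=` `[a, b] ->
    mu.-integrable A (EFin \o f) /\ mu.-integrable A (EFin \o g).
  by move=> mA Aab; split; [apply: integrableS fi|apply: integrableS gi].
have inner (c : R) (A : set R) (k : R -> R) (H : R -> \bar R) :
    measurable A -> mu.-integrable A (EFin \o k) ->
    (forall y, H y = (c * (k \_ A) y)%:E) ->
    (\int[mu]_y H y = (c * \int[mu]_(y in A) k y)%:E)%E.
  move=> mA ki HE.
  have kAi : mu.-integrable setT (EFin \o (k \_ A)).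
    by rewrite -restrict_EFin; apply: (integrable_mkcond _ _).1.
  under eq_integral do rewrite HE EFinM.
  rewrite integralZl// EFinM Rintegral_mkcond /Rintegral fineK//.
  exact: integrable_fin_num.
congr (_ = _); apply: (congr1 fine); apply: eq_integral => x _.
- rewrite /patch; case: ifPn => [|/negbTE xab]; last first.
    by rewrite integral0_eq// => y _; rewrite /h /fD /= /patch xab !mul0r.
  rewrite inE/= in_itv/= => /andP[ax xb].
  have xab : `]x, b] `<=` `[a, b] by apply: subset_itvr; rewrite bnd_simp.
  apply: inner => //; first exact: (sub_int _ _ xab).2.
  move=> y; rewrite /h /fD /gD /patch triE !mem_setE /= !in_itv/=.
  rewrite ax xb /= pt0; case: (ltP x y) => xy; last by rewrite !mulr0.
  by rewrite mulr1 (le_trans ax (ltW xy)).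
- rewrite /patch; case: ifPn => [|/negbTE xab]; last first.
    by rewrite integral0_eq// => y _; rewrite /h /gD /= /patch xab mulr0 mul0r.
  rewrite inE/= in_itv/= => /andP[ax xb].
  have xab : `[a, x[ `<=` `[a, b] by apply: subset_itvl; rewrite bnd_simp.
  rewrite -Rintegral_itv_bndo_bndc; last exact: (sub_int _ _ xab).1.
  apply: inner => //; first exact: (sub_int _ _ xab).1.
  move=> y; rewrite /h /fD /gD /patch triE !mem_setE /= !in_itv/=.
  rewrite ax xb /= pt0; case: (ltP y x) => xy; last by rewrite andbF !mulr0.
  by rewrite mulr1 (le_trans (ltW xy) xb) !andbT mulrC.
Qed.

Definition primitive_on a b F f :=
  mu.-integrable `[a, b] (EFin \o f) /\
  forall t, a <= t <= b -> F t = F a + \int[mu]_(s in `[a, t]) f s.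

Lemma eq_integrable_itv a b f g : {in `[a, b]%classic, f =1 g} ->
  mu.-integrable `[a, b] (EFin \o f) -> mu.-integrable `[a, b] (EFin \o g).
Proof. by move=> fg; apply: eq_integrable => // s /fg /= ->. Qed.

Lemma integrableD_itv a b f g :
  mu.-integrable `[a, b] (EFin \o f) -> mu.-integrable `[a, b] (EFin \o g) ->
  mu.-integrable `[a, b] (EFin \o (f \+ g)).
Proof. by move=> fi gi; exact: (integrableD _ fi gi). Qed.

Lemma integrableB_itv a b f g :
  mu.-integrable `[a, b] (EFin \o f) -> mu.-integrable `[a, b] (EFin \o g) ->
  mu.-integrable `[a, b] (EFin \o (f \- g)).
Proof. by move=> fi gi; apply: (integrableB _ fi gi). Qed.

Lemma integrableZl_itv a b c f : mu.-integrable `[a, b] (EFin \o f) ->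
  mu.-integrable `[a, b] (EFin \o (fun s => c * f s)).
Proof. by move=> fi; apply: (integrableZl _ c fi). Qed.

Lemma integrable_sub_itv f a b t : t <= b ->
  mu.-integrable `[a, b] (EFin \o f) -> mu.-integrable `[a, t] (EFin \o f).
Proof.
move=> tb fi; apply: integrableS fi => //.
by apply: subset_itvl; rewrite bnd_simp.
Qed.

Lemma integrable_mul_continuous f F a b :
  mu.-integrable `[a, b] (EFin \o f) -> {within `[a, b], continuous F} ->
  mu.-integrable `[a, b] (EFin \o (f \* F)).
Proof.
move=> fi cF; have cptab : compact `[a, b] by exact: segment_compact.
have mF : measurable_fun `[a, b] F.
  by apply: subspace_continuous_measurable_fun => //; exact: measurable_itv.
apply: (integrableMl _ fi mF) => //.
have /compact_bounded[M [_ MF]] := continuous_compact cF cptab.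
exists M; split; rewrite ?num_real// => N MN x abx.
by apply: MF => //; exists x.
Qed.

Lemma integral_mul f g a b :
  a <= b ->
  mu.-integrable `[a, b] (EFin \o f) -> mu.-integrable `[a, b] (EFin \o g) ->
  (\int[mu]_(s in `[a, b]) f s) * (\int[mu]_(s in `[a, b]) g s) =
  \int[mu]_(s in `[a, b])
    (f s * \int[mu]_(r in `[a, s]) g r + g s * \int[mu]_(r in `[a, s]) f r).
Proof.
move=> ab fi gi.
have cf := parameterized_integral_continuous ab fi.
have cg := parameterized_integral_continuous ab gi.
have fgi := integrable_mul_continuous fi cg.
have gfi := integrable_mul_continuous gi cf.
rewrite RintegralD// -(integral_triangle_swap fi gi) -RintegralZr//.
have fhi : mu.-integrable `[a, b]
    (EFin \o (fun s => f s * \int[mu]_(r in `]s, b]) g r)).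
  apply: (@eq_integrable_itv _ _ (fun s => (\int[mu]_(s in `[a, b]) g s) * f s -
                                           f s * \int[mu]_(r in `[a, s]) g r)).
    move=> s; rewrite inE/= in_itv/= => /andP[as_ sb].
    by rewrite mulrC -mulrBr Rintegral_itvB.
  apply: integrableB_itv => //.
  exact: integrableZl_itv.
rewrite -RintegralD//. apply: eq_Rintegral => s.
rewrite inE/= in_itv/= => /andP[as_ sb].
by rewrite -mulrDr -(Rintegral_itvB gi (x := s)) ?bnd_simp// subrKC.
Qed.

Lemma primitive_continuous a b F f :
  a <= b -> primitive_on a b F f -> {within `[a, b], continuous F}.
Proof.
move=> ab [fi FE].
apply: (@subspace_eq_continuous _ _ _
  (fun t => F a + \int[mu]_(s in `[a, t]) f s)).
  by move=> t; rewrite inE/= in_itv/= => tab; apply/esym; exact: FE.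
move=> t; have /(_ t) cI := parameterized_integral_continuous ab fi.
apply: cvgD; [exact: cvg_cst | exact: cI].
Qed.

Lemma primitive_mul a b F f G g :
  primitive_on a b F f -> primitive_on a b G g ->
  primitive_on a b (F \* G) (fun t => f t * G t + g t * F t).
Proof.
move=> PF PG; have [fi FE] := PF; have [gi GE] := PG.
have [ab|ba] := leP a b; last first.
  split; last by move=> t /andP[/le_trans h/h]; rewrite leNgt ba.
  by rewrite set_itv_ge ?bnd_simp -?ltNge//; exact: integrable_set0.
have cF := primitive_continuous ab PF.
have cG := primitive_continuous ab PG.
have fGi := integrable_mul_continuous fi cG.
have gFi := integrable_mul_continuous gi cF.
split; first exact: integrableD_itv.
move=> t /andP[at_ tb].
have {}fi := integrable_sub_itv tb fi.
have {}gi := integrable_sub_itv tb gi.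
have cIf := parameterized_integral_continuous at_ fi.
have cIg := parameterized_integral_continuous at_ gi.
have fIi := integrable_mul_continuous fi cIg.
have gIi := integrable_mul_continuous gi cIf.
rewrite (_ : \int[mu]_(s in `[a, t]) _ = \int[mu]_(s in `[a, t])
   ((f s * G a + g s * F a) +
    (f s * \int[mu]_(r in `[a, s]) g r +
     g s * \int[mu]_(r in `[a, s]) f r))); last first.
  apply: eq_Rintegral => s; rewrite inE/= in_itv/= => /andP[as_ st].
  have sab : a <= s <= b by rewrite as_ (le_trans st).
  rewrite (FE _ sab) (GE _ sab).
  move: (\int[mu]_(r in `[a, s]) f r) (\int[mu]_(r in `[a, s]) g r) => If Ig.
  ring.
have fci (k : R -> R) (c : R) : mu.-integrable `[a, t] (EFin \o k) ->
    mu.-integrable `[a, t] (EFin \o (fun s => k s * c)).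
  move=> ki; apply: eq_integrable_itv (integrableZl_itv c ki) => s _.
  by rewrite mulrC.
rewrite RintegralD//; last 2 first.
- by apply: integrableD_itv => //; exact: fci.
- exact: integrableD_itv.
rewrite RintegralD//; [|exact: fci..]; rewrite !RintegralZr// -integral_mul//.
have tab : a <= t <= b by rewrite at_.
rewrite /= (FE _ tab) (GE _ tab).
move: (\int[mu]_(s in `[a, t]) f s) (\int[mu]_(s in `[a, t]) g s) => If Ig.
ring.
Qed.

Lemma primitive_add a b F f G g :
  primitive_on a b F f -> primitive_on a b G g ->
  primitive_on a b (F \+ G) (f \+ g).
Proof.
move=> [fi FE] [gi GE]; split.
  exact: integrableD_itv.
move=> t tab; have /andP[_ tb] := tab.
have fti := integrable_sub_itv tb fi.
have gti := integrable_sub_itv tb gi.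
by rewrite /= (FE _ tab) (GE _ tab) RintegralD// addrACA.
Qed.

Lemma primitive_scale c a b F f : primitive_on a b F f ->
  primitive_on a b (fun t => c * F t) (fun t => c * f t).
Proof.
move=> [fi FE]; split; first exact: integrableZl_itv.
move=> t tab; have /andP[_ tb] := tab.
by rewrite (FE _ tab) RintegralZl ?mulrDr//; exact: integrable_sub_itv fi.
Qed.

Lemma primitive_le a b F f h : a <= b -> primitive_on a b F f ->
  mu.-integrable `[a, b] (EFin \o h) -> (forall t, a <= t <= b -> f t <= h t) ->
  F b <= F a + \int[mu]_(t in `[a, b]) h t.
Proof.
move=> ab [fi FE] hi fh; rewrite (FE b) ?lexx ?ab// lerD2l.
by apply: le_Rintegral => // t; rewrite /= in_itv/= => /fh.
Qed.

Lemma primitive_ae_derivable a b F f : primitive_on a b F f ->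
  {ae mu, forall t, a < t < b -> derivable F t 1 /\ derive1 F t = f t}.
Proof.
move=> [fi FE].
have /lebesgue_differentiation := integrable_locally (measurable_itv _) fi.
apply: filterS; first exact: (ae_filter_ringOfSetsType mu).
move=> t ft /andP[at_ tb].
have FF : \forall x \near t,
    F a + \int[mu]_(s in `[a, x]) (f \_ `[a, b]) s = F x.
  near=> x.
  have /andP[ax xb] : a <= x <= b.
    have /andP[/ltW -> /ltW ->] // : a < x < b.
    by near: x; apply: (near_in_itvoo (a := a) (b := b)); rewrite in_itv/= at_.
  rewrite (FE x) ?ax//; congr (_ + _); apply: eq_Rintegral => s.
  rewrite inE/= in_itv/= => /andP[as_ sx].
  by rewrite patchE mem_set//= in_itv/= as_ (le_trans sx).
have fri : mu.-integrable `[a, b] (EFin \o (f \_ `[a, b])).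
  apply: eq_integrable_itv fi => s sab.
  by rewrite patchE sab.
have at_' : (BLeft a < BRight t)%E by rewrite lte_fin.
have [dI dIE] := FTC1_lebesgue_pt tb fri at_' ft.
have dc := @derivable_cst R R R (F a) t 1.
have dcI := derivableD dc dI.
split; first exact: near_eq_derivable FF dcI.
rewrite derive1E -(near_eq_derive _ FF).
rewrite (deriveD dc dI) derive_cst add0r -derive1E.
by rewrite dIE patchE mem_set//= in_itv/= !ltW.
Unshelve. all: by end_near.
Qed.
End IndefiniteIntegral.

Section ClosedLoop.
Set Implicit Arguments.
Unset Strict Implicit.
Context {R : realType}.
Notation mu := (@lebesgue_measure R).

Definition quad3 (M : 'M[R]_3) (v eta vi : R) : R :=
  M 0 0 * v ^+ 2 + M 1 1 * eta ^+ 2 + M 2 2 * vi ^+ 2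
  + (M 0 1 + M 1 0) * (v * eta)
  + (M 0 2 + M 2 0) * (v * vi) + (M 1 2 + M 2 1) * (eta * vi).

Lemma sum_ord3 (F : 'I_3 -> R) : \sum_i F i = F 0 + F 1 + F 2.
Proof.
rewrite !big_ord_recl big_ord0 addr0 addrA.
by congr (F _ + F _ + F _); apply/val_inj.
Qed.

Lemma quad3E (M : 'M[R]_3) (e : 'cV[R]_3) :
  (e^T *m M *m e) 0 0 = quad3 M (e 0 0) (e 1 0) (e 2 0).
Proof.
rewrite !mxE sum_ord3 !mxE !sum_ord3 !mxE /quad3.
move: (M 0 0) (M 0 1) (M 0 2) (M 1 0) (M 1 1) (M 1 2) (M 2 0) (M 2 1) (M 2 2).
move: (e 0 0) (e 1 0) (e 2 0) => *; ring.
Qed.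

Lemma posdef_quad3_ge0 (M : 'M[R]_3) v eta vi :
  posdef M -> 0 <= quad3 M v eta vi.
Proof.
move=> [_ M0]; pose e : 'cV[R]_3 := colvec 3 [:: v; eta; vi].
have -> : quad3 M v eta vi = (e^T *m M *m e) 0 0 by rewrite quad3E !mxE.
have [->|/M0/ltW//] := eqVneq e 0.
by rewrite trmx0 !mul0mx mxE.
Qed.

Lemma affine_ge0 (A B lo hi x : R) : lo <= x <= hi ->
  0 <= A + B * lo -> 0 <= A + B * hi -> 0 <= A + B * x.
Proof. by move=> /andP[lox xhi]; have [B0|B0] := leP 0 B; nra. Qed.

Lemma young_sq (xl x p y : R) : 0 < xl -> xl <= x ->
  - (p * y) <= x / 4 * y ^+ 2 + p ^+ 2 / xl.
Proof.
move=> xl0 xlx; have : 0 <= (p + xl * y / 2) ^+ 2 / xl.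
  by rewrite divr_ge0 ?sqr_ge0// ltW.
have -> : (p + xl * y / 2) ^+ 2 / xl = p ^+ 2 / xl + p * y + xl / 4 * y ^+ 2.
  by field; rewrite gt_eqF.
have : 0 <= (x - xl) * y ^+ 2 by rewrite mulr_ge0 ?sqr_ge0// subr_ge0.
lra.
Qed.

Lemma quad3_Qmx_ge0 (beta psi kp alpha sigma_lo sigma_hi mu sigma : R)
    (z : design R) v eta vi :
  0 < alpha -> sigma_lo <= sigma <= sigma_hi ->
  feasible (gain_design beta psi kp alpha sigma_lo sigma_hi mu) z ->
  0 <= quad3 (Qmx beta psi kp z sigma) v eta vi.
Proof.
move=> a0 sI [_ P0 lo0 hi0 _].
have aP : 0 <= alpha * quad3 (Pmx z) v eta vi.
  by rewrite mulr_ge0 ?posdef_quad3_ge0// ltW.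
have ge0 s : posdef (Qmx beta psi kp z s - alpha *: Pmx z) ->
    0 <= quad3 (Qmx beta psi kp z s) v eta vi.
  move=> /posdef_quad3_ge0 => /(_ v eta vi) h.
  rewrite (le_trans (addr_ge0 h aP))// le_eqVlt; apply/orP; left; apply/eqP.
  rewrite /quad3.
  move: (Qmx _ _ _ _ _) => Q; rewrite !mxE.
  move: (Q 0 0) (Q 0 1) (Q 0 2) (Q 1 0) (Q 1 1) (Q 1 2) (Q 2 0) (Q 2 1) (Q 2 2).
  move: (Pmx z) => M.
  move: (M 0 0) (M 0 1) (M 0 2) (M 1 0) (M 1 1) (M 1 2) (M 2 0) (M 2 1) (M 2 2).
  move=> *; ring.
move/ge0: lo0; move/ge0: hi0.
pose A := quad3 (Qmx beta psi kp z 0) v eta vi.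
pose B := quad3 (Qmx beta psi kp z 1) v eta vi - A.
have QE s : quad3 (Qmx beta psi kp z s) v eta vi = A + B * s.
  rewrite /B /A /quad3 !mxE /=.
  move: (Pmx z) => M.
  move: (M 0 0) (M 0 1) (M 0 2) (M 1 0) (M 1 1) (M 1 2) (M 2 0) (M 2 1) (M 2 2).
  move=> *; ring.
by rewrite !QE => ? ?; apply: affine_ge0 sI _ _.
Qed.

Definition energy (P : 'M[R]_3) (x : 'cV[R]_(3 + 1)) : R :=
  (quad3 P (err x 0 0) (err x 1 0) (err x 2 0) + sigma_tilde x ^+ 2) / 2.

Definition energy_rate (P : 'M[R]_3) (x x' : 'cV[R]_(3 + 1)) : R :=
  (P 0 0 * err x 0 0 + P 0 1 * err x 1 0 + P 0 2 * err x 2 0) * err x' 0 0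
  + (P 1 0 * err x 0 0 + P 1 1 * err x 1 0 + P 1 2 * err x 2 0) * err x' 1 0
  + (P 2 0 * err x 0 0 + P 2 1 * err x 1 0 + P 2 2 * err x 2 0) * err x' 2 0
  + sigma_tilde x * sigma_tilde x'.

Lemma enorm_sqr (n : nat) (v : 'cV[R]_n) : enorm v ^+ 2 = \sum_i v i 0 ^+ 2.
Proof. by rewrite /enorm sqr_sqrtr// sumr_ge0// => i _; exact: sqr_ge0. Qed.

Lemma posdef_sym3 (P : 'M[R]_3) : posdef P ->
  [/\ P 1 0 = P 0 1, P 2 0 = P 0 2 & P 2 1 = P 1 2].
Proof. by move=> [PT _]; rewrite -{1 3 5}PT !mxE. Qed.

Lemma open_loop_component (beta psi sigma u w : R) (e : 'cV[R]_3) :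
  [/\ open_loop beta psi sigma u w e 0 0 = sigma * u - w,
      open_loop beta psi sigma u w e 1 0 =
        (psi - beta) * (e 1 0 - psi * e 2 0) + beta * e 0 0
    & open_loop beta psi sigma u w e 2 0 = e 1 0 - psi * e 2 0].
Proof. by rewrite !mxE. Qed.

Lemma err_col_mx (e : 'cV[R]_3) (s : 'cV[R]_1) : err (col_mx e s) = e.
Proof. exact: col_mxKu. Qed.

Lemma sigma_tilde_col_mx (e : 'cV[R]_3) (s : 'cV[R]_1) :
  sigma_tilde (col_mx e s) = s 0 0.
Proof. by rewrite /sigma_tilde col_mxKd. Qed.

Lemma energy_rate_le_supply (beta psi kp alpha sigma_lo sigma_hi mu0 sigma : R)
    (z : design R) (x : 'cV[R]_(3 + 1)) (d : 'cV[R]_1) :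
  0 < alpha -> sigma_lo <= sigma <= sigma_hi ->
  feasible (gain_design beta psi kp alpha sigma_lo sigma_hi mu0) z ->
  let S := closed_loop beta psi kp sigma (gain z) (Pmx z) in
  dom S x ->
  energy_rate (Pmx z) x (dyn S x d) <=
    L2_supply (1 / Num.sqrt (x_low z)) (dist S d) (output S x).
Proof.
move=> alpha0 sI zF S; rewrite /S {S} /= => sh0.
have [_ /posdef_sym3[P10 P20 P21] _ _ [xl1 xlv xle xli]] := zF.
have xl0 : 0 < x_low z by apply: lt_le_trans xl1.
have := quad3_Qmx_ge0 (err x 0 0) (err x 1 0) (err x 2 0) alpha0 sI zF.
rewrite /L2_supply /energy_rate !enorm_sqr !sum_ord3.
rewrite expr_div_n expr1n (sqr_sqrtr (ltW xl0)).
rewrite !err_col_mx sigma_tilde_col_mx.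
have [-> -> ->] := open_loop_component beta psi sigma
  (control_law kp (gain z) (sigma_hat sigma x) (err x)) (d 0 0) (err x).
have -> : sigma_tilde x = sigma - sigma_hat sigma x by rewrite /sigma_hat; ring.
have := young_sq (Pmx z 0 0 * d 0 0) (err x 0 0) xl0 xlv.
have := young_sq (Pmx z 0 1 * d 0 0) (err x 1 0) xl0 xle.
have := young_sq (Pmx z 0 2 * d 0 0) (err x 2 0) xl0 xli.
move: sh0 xl0 {xl1 xlv xle xli zF}.
rewrite /control_law /adaptive_law /quad3.
move: (err x) (sigma_hat sigma x) => e sh sh0 xl0.
rewrite !mxE /= P10 P20 P21 mulr1n.
move: xl0 {P10 P20 P21}.
move: (e 0 0) (e 1 0) (e 2 0) (d 0 0) => v eta vi w.
case: z => k xl xv xe xi P /=.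
move: (P 0 0) (P 0 1) (P 0 2) (P 1 1) (P 1 2) (P 2 2) => pv pve pvi pe pei pi.
move=> xl0 Yi Ye Yv Q0; rewrite -subr_ge0; rewrite -subr_ge0 in Yi.
rewrite -subr_ge0 in Ye; rewrite -subr_ge0 in Yv.
apply: le_trans (addr_ge0 Q0 (addr_ge0 Yv (addr_ge0 Ye Yi))) _.
rewrite le_eqVlt; apply/orP; left; apply/eqP; field.
by rewrite sh0 gt_eqF.
Qed.
Lemma energy_ge0 (P : 'M[R]_3) (x : 'cV[R]_(3 + 1)) :
  posdef P -> 0 <= energy P x.
Proof.
by move=> P0; rewrite divr_ge0// addr_ge0 ?sqr_ge0// posdef_quad3_ge0.
Qed.

Lemma primitive_energy (P : 'M[R]_3) (a b : R) (x x' : R -> 'cV[R]_(3 + 1)) :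
  posdef P ->
  (forall i, primitive_on a b (fun t => x t i 0) (fun t => x' t i 0)) ->
  primitive_on a b (energy P \o x) (fun t => energy_rate P (x t) (x' t)).
Proof.
move=> /posdef_sym3[P10 P20 P21] xx'.
have mX i j := primitive_mul (xx' (lshift 1 i)) (xx' (lshift 1 j)).
have mY := primitive_mul (xx' (rshift 3 0)) (xx' (rshift 3 0)).
pose sc c i j := primitive_scale c (mX i j).
have := primitive_add (primitive_add (primitive_add (sc (P 0 0 / 2) 0 0)
  (primitive_add (sc (P 1 1 / 2) 1 1) (sc (P 2 2 / 2) 2 2)))
  (primitive_add (sc (P 0 1) 0 1)
    (primitive_add (sc (P 0 2) 0 2) (sc (P 1 2) 1 2))))
  (primitive_scale 2^-1 mY).
congr (primitive_on _ _ _ _); apply/funext => t /=.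
  rewrite /energy /quad3 /sigma_tilde P10 P20 P21 !mxE.
  move: (x t _ _) (x t _ _) (x t _ _) (x t _ _) => *; by field.
rewrite /energy_rate /sigma_tilde P10 P20 P21 !mxE.
move: (x t _ _) (x t _ _) (x t _ _) (x t _ _) => ? ? ? ?.
move: (x' t _ _) (x' t _ _) (x' t _ _) (x' t _ _) => *; by field.
Qed.

Lemma L2e_integrable_sqr (u : R -> R) (a b : R) : 0 <= a -> a <= b -> L2e u ->
  mu.-integrable `[a, b] (EFin \o (fun t => u t ^+ 2)).
Proof.
move=> a0 ab /(_ b (le_trans a0 ab)) /Lfun2_integrable_sqr ui.
apply: (@eq_integrable_itv _ _ _ (fun t => (u \_ `[0, b]) t ^+ 2)).
  move=> t; rewrite inE/= in_itv/= => /andP[at_ tb].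
  by rewrite patchE mem_set//= in_itv/= (le_trans a0).
exact: integrableS ui.
Qed.

Lemma primitive_integrable_sqr a b (F f : R -> R) :
  a <= b -> primitive_on a b F f ->
  mu.-integrable `[a, b] (EFin \o (fun t => F t ^+ 2)).
Proof.
move=> ab /(primitive_continuous ab) cF.
have Fi : mu.-integrable `[a, b] (EFin \o F).
  by apply: continuous_compact_integrable => //; exact: segment_compact.
apply: eq_integrable_itv (integrable_mul_continuous Fi cF) => t _.
by rewrite expr2.
Qed.

Lemma supply_integrable (c0 c1 c2 g a b : R) (u : R -> R)
    (x x' : R -> 'cV[R]_(3 + 1)) :
  0 <= a -> a <= b -> L2e u ->
  (forall i, primitive_on a b (fun t => x t i 0) (fun t => x' t i 0)) ->
  mu.-integrable `[a, b] (EFin \o (fun t =>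
    L2_supply g (colvec 3 [:: c0 * u t; c1 * u t; c2 * u t]) (err (x t)))).
Proof.
move=> a0 ab uL xx'.
have ui := L2e_integrable_sqr a0 ab uL.
have xi i := primitive_integrable_sqr ab (xx' (lshift 1 i)).
apply: (eq_integrable_itv _ (integrableB_itv
  (integrableZl_itv (g ^+ 2 * (c0 ^+ 2 + c1 ^+ 2 + c2 ^+ 2)) ui)
  (integrableD_itv (integrableD_itv (xi 0) (xi 1)) (xi 2)))) => t _.
by rewrite /L2_supply !enorm_sqr !sum_ord3 !mxE /=; ring.
Qed.

End ClosedLoop.

Theorem theorem1 (R : realType)
    (beta psi kp alpha sigma_lo sigma_hi mu sigma : R)
    (beta_gt0 : 0 < beta) (psi_gt0 : 0 < psi) (kp_gt0 : 0 < kp)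
    (alpha_gt0 : 0 < alpha)
    (sigma_lo_gt0 : 0 < sigma_lo) (sigma_lo_hi : sigma_lo <= sigma_hi)
    (sigma_itv : sigma_lo <= sigma <= sigma_hi)
    (z : design R)
    (z_feasible :
       feasible (gain_design beta psi kp alpha sigma_lo sigma_hi mu) z) :
  let gamma_bar := 1 / Num.sqrt (x_low z) in
  let S := closed_loop beta psi kp sigma (gain z) (Pmx z) in
  [/\ 0 < gamma_bar <= 1,
      forall (x : 'cV[R]_(3 + 1)) (w : 'cV[R]_1), dom S x ->
        err (dyn S x w) 0 0 =
          - (gain z * (sigma_tilde x / sigma_hat sigma x) * err x 0 0)
          - gain z * err x 0 0 - sigma * kp * err x 1 0 - w 0 0
    & gamma_dissipative S gamma_bar].
Proof.
move=> gamma_bar S; have [_ P_posdef _ _ [xl1 _ _ _]] := z_feasible.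
have sqrt_ge1 : 1 <= Num.sqrt (x_low z) by rewrite -sqrtr1 ler_wsqrtr.
have rate_le x d : dom S x ->
    energy_rate (Pmx z) x (dyn S x d) <=
      L2_supply gamma_bar (dist S d) (output S x).
  exact: energy_rate_le_supply alpha_gt0 sigma_itv z_feasible.
split.
- by rewrite /gamma_bar div1r invr_gt0 invf_le1 (lt_le_trans ltr01 sqrt_ge1).
- move=> x w sh0; rewrite /= err_col_mx.
  have [-> _ _] := open_loop_component beta psi sigma
    (control_law kp (gain z) (sigma_hat sigma x) (err x)) (w 0 0) (err x).
  rewrite /control_law.
  have -> : sigma_tilde x = sigma - sigma_hat sigma x.
    by rewrite /sigma_hat; ring.
  by field.
exists (energy (Pmx z)); split=> [x|t0 tf d x t0_ge0 t0tf dL2 [xdom xdyn]|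
    t0 tf d x t0_ge0 t0tf dL2 [xdom xdyn]].
- exact: energy_ge0.
- have si := supply_integrable (Pmx z 0 0) (Pmx z 0 1) (Pmx z 0 2) gamma_bar
    t0_ge0 t0tf (dL2 0) xdyn.
  have := primitive_le t0tf (primitive_energy P_posdef xdyn) si
    (fun t tI => rate_le _ (d t) (xdom t tI)).
  rewrite -lee_fin EFinD /Rintegral fineK//.
  exact: integrable_fin_num.
- have := primitive_ae_derivable (primitive_energy P_posdef xdyn).
  apply: filterS => [|t dE tI].
    exact: (ae_filter_ringOfSetsType (@lebesgue_measure R)).
  have [dV ->] := dE tI; split => //; apply/rate_le/xdom.
  by have /andP[/ltW -> /ltW ->] := tI.
Qed.
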